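(* Let $\phi>0$ and $Y\in\mathbb{R}$. Then there exists a unique global-in-time solution $(s,p,\Gamma)$ (in the sense defined in the context) to the free boundary problem \[ \begin{array}{lll} (i)& \dfrac{\partial^2 p}{\partial x^2}(x,t) = 2Y\,(1-\Gamma(x,t)), & 0<x<s(t),\ t>0,\\[2mm] (ii)& -\dfrac{\partial p}{\partial x}(s(t),t) = 2\phi\, s'(t), & t>0,\\[2mm] (iii)& \dfrac{\partial \Gamma}{\partial t}(x,t) = 1-\Gamma(x,t), & 0<x<s(t),\ t>0,\\[2mm] (iv)& p(0,t)=1,\quad p(s(t),t)=0, & t>0,\\ (v)& \Gamma(s(t),t)=0, & t>0,\\ (vi)& s(0)=0. & \end{array} \] Moreover, the free boundary $s$ is a strictly increasing function, and the solution is given by the following formulas. For $t\ge 0$, \[ s(t)=\sqrt{\frac{t}{\phi+Y}+\frac{Y}{(\phi+Y)^2}\left(1-\exp\left(-\left(1+\frac{Y}{\phi}\right)t\right)\right)}\quad\text{if } \phi+Y\neq 0, \] \[ s(t)=\sqrt{\frac{t}{\phi}+\frac{t^2}{2\phi}}\quad\text{if } \phi+Y=0; \] and, for $t>0$ and $0\le x\le s(t)$, with $s^{-1}$ denoting the inverse function of $s$, \[ \Gamma(x,t)=1-\exp\left(s^{-1}(x)-t\right), \] \[ p(x,t)=1-2\phi\, s'(t)\,x-2Y\int_0^x\int_y^{s(t)}\exp\left(s^{-1}(z)-t\right)\,dz\,dy . \]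
   Context: This is a dimensionless one-dimensional model of water infiltration coupled with a hydration reaction: $s(t)$ is the position of the infiltration front, $p$ the pressure, $\Gamma$ the extent of the reaction, $\phi$ the porosity, and $Y$ the volume of water consumed by the reaction per unit volume of medium. A (global-in-time) solution is a triple $(s,p,\Gamma)$ satisfying (i)–(vi), where: - $s:[0,\infty)\to[0,\infty)$ is continuous on $[0,\infty)$ and $C^1$ on $(0,\infty)$; - with $Q=\{(x,t): 0\le x\le s(t),\ t>0\}$, $p\in C(Q)$ and $p(\cdot,t)\in C^2((0,s(t)))$ for every $t>0$; the derivative $\frac{\partial p}{\partial x}(s(t),t)$ in (ii) is the one-sided one, i.e. the limit of $\frac{\partial p}{\partial x}(x,t)$ as $x\to s(t)^-$; - $\Gamma$ is a bounded measurable function on $Q$ (functions differing only on the set $\{x=0\}$ are identified). For $x>0$ with $x<s(t)$ for some $t$, let $h(x)=\inf\{t>0: s(t)>x\}$ be the arrival time of the front at $x$. For every such $x$ one requires that $(x,t)\in Q$ for all $t\ge h(x)$, that $\Gamma(x,\cdot)$ is $C^1$ on $(h(x),\infty)$, and that $\Gamma(x,\cdot)$ is continuous on $[h(x),\infty)$, so that (v) acts as an initial condition for (iii). *)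

(* Defs.v *)
From HB Require Import structures.
From mathcomp Require Import all_boot all_order all_algebra.
From mathcomp Require Import all_classical all_reals all_analysis.
From mathcomp Require Import measurable_realfun.

Set Implicit Arguments.
Unset Strict Implicit.
Unset Printing Implicit Defensive.

Import Order.TTheory GRing.Theory Num.Theory.
Import numFieldNormedType.Exports.

Local Open Scope classical_set_scope.
Local Open Scope ring_scope.

(* Only meant for open A: derive1 is the two-sided derivative, so on an open   *)
(* set it does not see the values of f outside A.                              *)
Definition C1_on (R : realType) (A : set R) (f : R -> R) : Prop :=
  (forall x, A x -> derivable f x 1) /\ {within A, continuous (derive1 f)}.

Definition C2_on (R : realType) (A : set R) (f : R -> R) : Prop :=
  (forall x, A x -> derivable f x 1) /\ C1_on A (derive1 f).

(* Points of the plane are pairs (x, t): position first, time second.          *)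
Definition wet_region (R : realType) (s : R -> R) : set (R * R) :=
  [set z | 0 <= z.1 <= s z.2 /\ 0 < z.2].

Definition arrival_time (R : realType) (s : R -> R) (x : R) : R :=
  inf [set t | 0 < t /\ x < s t].

(* The plane with the Lebesgue sigma-algebra, i.e. the completion of the       *)
(* product sigma-algebra with respect to the product measure.                  *)
Definition lebesgue_plane (R : realType) :=
  g_sigma_algebraType (completed_algebra_gen
    (@lebesgue_measure R \x @lebesgue_measure R)%E).

(* The unknowns are total functions, of which only the restrictions of s to    *)
(* [0, +oo[ and of p and Gamma to the wet region are constrained.              *)
Record is_solution (R : realType) (phi Y : R)
    (s : R -> R) (p Gamma : R -> R -> R) : Prop := IsSolution {
  front_ge0 : forall t, 0 <= t -> 0 <= s t ;
  front_continuous : {within `[0, +oo[, continuous s} ;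
  front_C1 : C1_on `]0, +oo[ s ;
  pressure_continuous :
    {within wet_region s, continuous (fun z : R * R => p z.1 z.2)} ;
  pressure_C2 : forall t, 0 < t -> C2_on `]0, (s t)[ (fun x => p x t) ;
  reaction_bounded : exists M : R,
    forall x t, wet_region s (x, t) -> `|Gamma x t| <= M ;
  reaction_measurable :
    measurable_fun (wet_region s : set (lebesgue_plane R))
      (fun z => Gamma z.1 z.2) ;
  reaction_regular : forall x, 0 < x -> (exists2 t, 0 <= t & x < s t) ->
    [/\ forall t, arrival_time s x <= t -> wet_region s (x, t),
        C1_on `]arrival_time s x, +oo[ (Gamma x) &
        {within `[arrival_time s x, +oo[, continuous (Gamma x)}] ;
  pressure_equation : forall x t, 0 < t -> 0 < x < s t ->
    derive1 (derive1 (fun y => p y t)) x = 2 * Y * (1 - Gamma x t) ;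
  front_equation : forall t, 0 < t ->
    - derive1 (fun y => p y t) x @[x --> (s t)^'-] --> 2 * phi * derive1 s t ;
  reaction_equation : forall x t, 0 < t -> 0 < x < s t ->
    derive1 (Gamma x) t = 1 - Gamma x t ;
  pressure_boundary : forall t, 0 < t -> p 0 t = 1 /\ p (s t) t = 0 ;
  reaction_front : forall t, 0 < t -> Gamma (s t) t = 0 ;
  front_start : s 0 = 0 }.

(* Gamma is only determined up to its values on the line x = 0.                *)
Definition same_solution (R : realType)
    (s1 : R -> R) (p1 Gamma1 : R -> R -> R)
    (s2 : R -> R) (p2 Gamma2 : R -> R -> R) : Prop :=
  [/\ forall t, 0 <= t -> s1 t = s2 t,
      forall x t, wet_region s1 (x, t) -> p1 x t = p2 x t &
      forall x t, wet_region s1 (x, t) -> 0 < x -> Gamma1 x t = Gamma2 x t].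

(* Inverse of the restriction of s to [0, +oo[; the default value 0 is only    *)
(* taken outside s @` [0, +oo[.                                                *)
Definition front_inv (R : realType) (s : R -> R) : R -> R :=
  'pinv_(fun=> 0) `[0, +oo[ s.

(* Main.v *)
(* Fix t and put m_t(x) = e^t (x p_x - p + 1).  Since Gamma = 1 - e^(h(x) - t) *)
(* with h the arrival time, (i) gives m_t' = 2 Y x e^(h(x)), which does not    *)
(* depend on t, and (iv) gives m_t(0+) = 0; so m_t is the same function m for  *)
(* all t.  The conditions at the front give m(s(t)) = e^t (1 - 2 phi s s'),    *)
(* and differentiating in t, with h(s(t)) = t, shows that V = m o s solves     *)
(* V' = (Y / phi) (e^t - V), V(0+) = 0.  This linear equation determines       *)
(* s s', hence s^2, then Gamma and, by its two boundary values, p.             *)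
(* Conversely w = s^2 solves phi w'' + (phi + Y) w' = 1, w(0) = 0,             *)
(* w'(0) = 1 / phi; its explicit solution has w' bounded below by a positive   *)
(* constant, so sqrt w is an increasing bijection of [0, +oo[.                 *)

Require Import Defs.
From HB Require Import structures.
From mathcomp Require Import all_boot all_order all_algebra.
From mathcomp Require Import all_classical all_reals all_analysis.
From mathcomp Require Import measurable_realfun.
From mathcomp Require Import ring lra.
Import Order.TTheory GRing.Theory Num.Theory.
Import numFieldNormedType.Exports.
Local Open Scope classical_set_scope.
Local Open Scope ring_scope.

Set Implicit Arguments.
Unset Strict Implicit.
Unset Printing Implicit Defensive.

(** * Calculus on intervals *)

(** The front speed depends on the whole reaction profile through the pressure; the weight x removes
    this nonlocality. For every solution the front is monotone ([front_ndecr]), so (iii) and (v)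
    give Gamma = 1 - e^(h(x) - t) with h the arrival time ([reaction_formula]), and t enters p_xx
    only through the factor e^(-t). As (x p_x - p)' = x p_xx, the quantity [moment] has an
    x-derivative free of t and limit 0 at x = 0, so it does not depend on t ([moment_indep]), while
    (ii) and (iv) give its limit V(t) = e^t (1 - 2 phi s s') at the front ([moment_at_front]). This
    forces strict growth of s ([front_incr]) and V' = 2 Y e^t s s' with V(0+) = 0
    ([front_defect_is_derive], [front_defect_at_0]). Since s s' is affine in e^(-t) V, the equation
    is linear, and two solutions share s s' ([front_speed_unique]), hence s, the arrival times,
    Gamma and p.

    For existence, [profile_exists] gives w = s^2 explicitly; the construction then uses only its
    differential equation, its initial values and the bound w' >= c > 0, which treats phi + Y = 0
    and phi + Y <> 0 together. Primitives A and C of e^(h(x)) and x e^(h(x)), with h the inverse of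
    s, yield p. The delicate condition, p = 0 at the front, is [C_front], the integrated form of the
    equation for V; [profile_pressure] recovers the double integral. *)

Lemma eq_of_derive0 (R : realType) (f : R -> R) (x y : R) : x < y ->
  (forall z, x <= z <= y -> is_derive z 1 f 0) -> f x = f y.
Proof.
move=> xy df.
have cf : {within `[x, y], continuous f}.
  by apply: derivable_within_continuous => z; rewrite in_itv/= => /df[].
have df' z : z \in `]x, y[ -> is_derive z (1:R) f ((fun=> 0 : R) z).
  by move=> /subset_itv_oo_cc; rewrite in_itv/= => /df.
have mvt := MVT xy df' cf.
case: mvt => c _ /eqP; rewrite mul0r subr_eq0 => /eqP ->//.
Qed.

(** The equations below hold on open intervals with data at an end, so the constant is read off as a
    right limit at [a]. Linear equations are brought to this form by an integrating factor. *)
Lemma eq_lim_of_derive0 (R : realType) (f : R -> R) (a b l : R) :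
  (forall x, a < x < b -> is_derive x 1 f 0) ->
  f x @[x --> a^'+] --> l -> forall x, a < x < b -> f x = l.
Proof.
move=> df fl x /andP[ax xb].
have fcst : f y @[y --> a^'+] --> f x.
  apply: cvg_near_cst; near=> y.
  have ay : a < y by near: y; exact: nbhs_right_gt.
  have yx : y < x by near: y; exact: nbhs_right_lt.
  apply: eq_of_derive0 yx _ => z /andP[yz zx]; apply: df.
  by rewrite (lt_le_trans ay yz) (le_lt_trans zx xb).
exact: (cvg_unique _ fcst fl).
Unshelve. all: by end_near. Qed.

Lemma derivable_is_derive1 (R : realType) (f : R -> R) (x : R) :
  derivable f x 1 -> is_derive x 1 f (derive1 f x).
Proof. by move=> df; rewrite derive1E; exact: derivableP. Qed.

Lemma is_derive1_derive1 (R : realType) (f : R -> R) (x a : R) :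
  is_derive x 1 f a -> derive1 f x = a.
Proof. by move=> df; rewrite derive1E; exact: derive_val. Qed.

Lemma is_derive1_continuous (R : realType) (f : R -> R) (x a : R) :
  is_derive x 1 f a -> {for x, continuous f}.
Proof.
by move=> [df _]; apply: differentiable_continuous; exact/derivable1_diffP.
Qed.

(** * Uniqueness *)

Section Front.
Context (R : realType) (phi Y : R) (s : R -> R) (p Gamma : R -> R -> R).
Hypothesis sol : is_solution phi Y s p Gamma.

(** With [s t = 0] both conditions in (iv) would bear on the same point, giving 1 = 0. *)
Lemma front_pos (t : R) : 0 < t -> 0 < s t.
Proof.
move=> t0; rewrite lt_neqAle (front_ge0 sol (ltW t0)) andbT.
apply/eqP => st; have [p0 ps] := pressure_boundary sol t0.
by move: ps; rewrite -st p0 => /eqP; rewrite oner_eq0.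
Qed.

Lemma front_is_derive (t : R) : 0 < t -> is_derive t 1 s (derive1 s t).
Proof.
move=> t0; apply: derivable_is_derive1; apply: (front_C1 sol).1.
by rewrite /= in_itv/= t0.
Qed.

Lemma front_continuous_at (t : R) : 0 < t -> {for t, continuous s}.
Proof. by move=> t0; exact: is_derive1_continuous (front_is_derive t0). Qed.

Lemma front_at_0 : s t @[t --> 0^'+] --> 0.
Proof.
have /continuous_within_itvcyP[_] := front_continuous sol.
by rewrite (front_start sol).
Qed.

Lemma arrival_le (t x : R) : 0 < t -> x < s t -> arrival_time s x <= t.
Proof.
move=> t0 xt; apply: ge_inf => //.
by exists 0 => u [u0 _]; exact: ltW.
Qed.

(* If s u < s t with t < u, a point between them is reached by time t, hence   *)
(* wet at time u.                                                              *)
Lemma front_ndecr (t u : R) : 0 <= t -> t <= u -> s t <= s u.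
Proof.
move=> t0 tu; rewrite leNgt; apply/negP => sut.
have su0 : 0 <= s u by apply: (front_ge0 sol); exact: le_trans tu.
have {t0} t0 : 0 < t.
  rewrite lt_neqAle t0 andbT; apply/eqP => t0'.
  by move: sut; rewrite -t0' (front_start sol) ltNge su0.
pose x := (s t + s u) / 2.
have x0 : 0 < x by rewrite /x; lra.
have xt : x < s t by rewrite /x; lra.
have [|wet _ _] := reaction_regular sol x0; first by exists t => //; exact: ltW.
have [/= /andP[_ xu] _] := wet u (le_trans (arrival_le t0 xt) tu).
by move: xu; rewrite /x; lra.
Qed.

Lemma lt_front (t x : R) : 0 < x -> (exists2 u, 0 <= u & x < s u) ->
  arrival_time s x < t -> x < s t.
Proof.
move=> x0 [u u0 xu] ht.
have u_gt0 : 0 < u.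
  rewrite lt_neqAle u0 andbT; apply/eqP => u0'.
  by move: xu; rewrite -u0' (front_start sol) ltNge ltW.
have hinf : has_inf [set t | 0 < t /\ x < s t].
  by split; [exists u|exists 0 => v [v0 _]; exact: ltW].
have th : 0 < t - arrival_time s x by rewrite subr_gt0.
have [e [e0 xe]] := inf_adherent th hinf.
rewrite -/(arrival_time s x) addrC subrK => et.
exact: lt_le_trans xe (front_ndecr (ltW e0) (ltW et)).
Qed.

(** The point is required to be wet at the arrival time itself, which makes this time positive and
    [s] there at least [x]. Were it larger, continuity would give an earlier time at which the front
    has passed [x]. *)
Lemma front_arrival (x : R) : 0 < x -> (exists2 u, 0 <= u & x < s u) ->
  0 < arrival_time s x /\ s (arrival_time s x) = x.
Proof.
move=> x0 xu; have [wet _ _] := reaction_regular sol x0 xu.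
have [/= /andP[_ xh] h0] := wet _ (lexx _).
split => //; apply/eqP; rewrite eq_le xh andbT leNgt; apply/negP => xsh.
have : \forall t \near (arrival_time s x)^'-,
    [/\ 0 < t, t < arrival_time s x & x < s t].
  near=> t; split; first by near: t; exact: nbhs_left_gt.
  - by near: t; exact: nbhs_left_lt.
  - near: t; apply: (cvgr_gt (s (arrival_time s x))) => //.
    exact/cvg_at_left_filter/front_continuous_at.
move=> /filter_ex[t [t0 th xt]].
by have := arrival_le t0 xt; rewrite leNgt th.
Unshelve. all: by end_near. Qed.

Lemma reaction_formula (x t : R) : 0 < t -> 0 < x < s t ->
  arrival_time s x <= t /\ Gamma x t = 1 - expR (arrival_time s x - t).
Proof.
move=> t0 /andP[x0 xt].
have xu : exists2 u, 0 <= u & x < s u by exists t => //; exact: ltW.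
have [h0 sh] := front_arrival x0 xu.
have [_ [dG _] cG] := reaction_regular sol x0 xu.
set h := arrival_time s x in h0 sh dG cG *.
have ht : h < t.
  rewrite lt_neqAle (arrival_le t0 xt) andbT; apply/eqP => hE.
  by move: xt; rewrite -sh hE ltxx.
split; first exact: ltW.
(* Integrating factor for (iii): [f] is constant after the arrival time, where (v) gives its value.
   The bound [t + 1] only puts [t] inside an open interval. *)
pose f u := expR u * (Gamma x u - 1).
have df u : h < u < t + 1 -> is_derive u 1 f 0.
  move=> /andP[hu _]; have u0 := lt_trans h0 hu.
  have xsu : 0 < x < s u by rewrite x0; apply: lt_front.
  have du : is_derive u 1 (Gamma x) (1 - Gamma x u).
    rewrite -(reaction_equation sol u0 xsu); apply: derivable_is_derive1.
    by apply: dG; rewrite /= in_itv/= hu.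
  rewrite /f; apply: is_derive_eq; rewrite /GRing.scale/=; ring.
have fh : f u @[u --> h^'+] --> expR h * (Gamma x h - 1).
  apply: cvgM; first exact/cvg_at_right_filter/continuous_expR.
  apply: cvgB; last exact: cvg_cst.
  by have /continuous_within_itvcyP[] := cG.
have Gh : Gamma x h = 0 by rewrite -sh -/h (reaction_front sol).
have := eq_lim_of_derive0 df fh (x := t); rewrite ht ltrDl ltr01 => /(_ isT).
rewrite /f Gh sub0r mulrN1 expRD expRN => fE.
have et := expR_gt0 t; have et0 : expR t != 0 by rewrite gt_eqF.
have -> : expR h = - (expR t * (Gamma x t - 1)) by rewrite fE opprK.
by field.
Qed.

End Front.

(** * The moment of the pressure and its independence of time *)

Section Moment.
Context (R : realType) (phi Y : R) (s : R -> R) (p Gamma : R -> R -> R).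
Hypothesis sol : is_solution phi Y s p Gamma.

Let px (t : R) : R -> R := derive1 (fun x => p x t).

Lemma pressure_is_derive (x t : R) : 0 < t -> 0 < x < s t ->
  is_derive x 1 (fun y => p y t) (px t x).
Proof.
move=> t0 xt; apply: derivable_is_derive1; apply: (pressure_C2 sol t0).1.
by rewrite /= in_itv.
Qed.

Lemma pressure_is_derive2 (x t : R) : 0 < t -> 0 < x < s t ->
  is_derive x 1 (px t) (2 * Y * expR (arrival_time s x - t)).
Proof.
move=> t0 xt; have -> : 2 * Y * expR (arrival_time s x - t) = derive1 (px t) x.
  rewrite (pressure_equation sol t0 xt).
  by have [_ ->] := reaction_formula sol t0 xt; rewrite subKr.
apply: derivable_is_derive1; apply: (pressure_C2 sol t0).2.1.
by rewrite /= in_itv.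
Qed.

Lemma pressure_within (t : R) : 0 < t ->
  {within `[0, s t], continuous (fun x => p x t)}.
Proof.
move=> t0; apply/subspace_continuousP => x /=; rewrite in_itv/= => xt.
have /subspace_continuousP/(_ (x, t)) := pressure_continuous sol.
move=> /(_ (conj xt t0)) cp.
apply: (cvg_comp (fun y => (y, t)) (fun z : R * R => p z.1 z.2) _ cp).
move=> P [[A B] /= [xA tB] AB].
apply: filter_app xA; rewrite near_simpl/=.
apply: filterE => y yA; rewrite in_itv/= => yt.
by apply: (AB (y, t)); [split => //=; exact: nbhs_singleton|split].
Qed.

Lemma pressure_at_0 (t : R) : 0 < t -> p x t @[x --> 0^'+] --> (1 : R).
Proof.
move=> t0; have st := front_pos sol t0.
have /(continuous_within_itvP _ st)[_ + _] := pressure_within t0.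
by have [-> _] := pressure_boundary sol t0.
Qed.

Lemma pressure_at_front (t : R) : 0 < t -> p x t @[x --> (s t)^'-] --> (0 : R).
Proof.
move=> t0; have st := front_pos sol t0.
have /(continuous_within_itvP _ st)[_ _] := pressure_within t0.
by have [_ ->] := pressure_boundary sol t0.
Qed.

(** Compare p_x with its value at the midpoint by the mean value theorem: |p_xx| <= 2 |Y| because
    the arrival time is at most [t]. The bound makes x p_x tend to 0 at x = 0. *)
Lemma pressure_gradient_bounded (t : R) : 0 < t ->
  exists K, forall x, 0 < x <= s t / 2 -> `|px t x| <= K.
Proof.
move=> t0; have st := front_pos sol t0.
pose c := s t / 2; have c0 : 0 < c by rewrite /c; lra.
have cs : c < s t by rewrite /c; lra.
have YC : 0 <= 2 * `|Y| * c by rewrite !mulr_ge0// ltW.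
exists (`|px t c| + 2 * `|Y| * c) => x /andP[x0].
rewrite le_eqVlt => /orP[/eqP -> |xc]; first by rewrite lerDl.
have dpx z : x <= z <= c ->
    is_derive z 1 (px t) (2 * Y * expR (arrival_time s z - t)).
  move=> /andP[xz zc]; apply: pressure_is_derive2 => //.
  by rewrite (lt_le_trans x0 xz) (le_lt_trans zc cs).
have cpx : {within `[x, c], continuous (px t)}.
  by apply: derivable_within_continuous => z; rewrite in_itv/= => /dpx[].
have dpx' z : z \in `]x, c[ ->
    is_derive z (1 : R) (px t) (2 * Y * expR (arrival_time s z - t)).
  by move=> /subset_itv_oo_cc; rewrite in_itv/= => /dpx.
have [z] := MVT xc dpx' cpx.
rewrite in_itv/= => /andP[xz zc] mvt.
have -> : px t x = px t c - 2 * Y * expR (arrival_time s z - t) * (c - x).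
  by rewrite -mvt; ring.
apply: (le_trans (ler_normB _ _)); rewrite lerD2l !normrM normr_nat.
rewrite (ger0_norm (expR_ge0 _)) (@ger0_norm _ (c - x)) ?subr_ge0 ?(ltW xc)//.
rewrite -!mulrA ler_wpM2l// ler_wpM2l// -(mul1r c) ler_pM// ?expR_ge0//.
- by rewrite subr_ge0 mul1r ltW.
- rewrite -expR0 ler_expR subr_le0.
  have zt : 0 < z < s t by rewrite (lt_trans x0 xz) (lt_trans zc cs).
  by have [] := reaction_formula sol t0 zt.
- by rewrite mul1r lerBlDr lerDl ltW.
Qed.

(** Here p - x p_x is the intercept at 0 of the tangent to p at [x]. For a solution this is the
    first moment of 2 Y e^(h(y)) over y in [0, x], whence the name. *)
Definition moment (t x : R) : R :=
  expR t * (x * derive1 (fun y => p y t) x - p x t + 1).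

Lemma moment_is_derive (x t : R) : 0 < t -> 0 < x < s t ->
  is_derive x 1 (moment t) (2 * Y * x * expR (arrival_time s x)).
Proof.
move=> t0 xt; have dp := pressure_is_derive t0 xt.
have dpx := pressure_is_derive2 t0 xt.
have d : is_derive x 1 (fun x => expR t * (x * px t x - p x t + 1))
   (2 * Y * x * expR (arrival_time s x)).
  apply: is_derive_eq; rewrite /GRing.scale/= expRD expRN.
  have et0 : expR t != 0 by rewrite gt_eqF ?expR_gt0.
  by field.
exact: d.
Qed.

Lemma moment_at_0 (t : R) : 0 < t -> moment t x @[x --> 0^'+] --> (0 : R).
Proof.
move=> t0; have st := front_pos sol t0.
have [K Kpx] := pressure_gradient_bounded t0.
rewrite -[X in _ --> X](_ : expR t * (0 - 1 + 1) = 0); last by ring.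
apply: cvgM; first exact: cvg_cst.
apply: cvgD; last exact: cvg_cst.
apply: cvgB; last exact: pressure_at_0.
have K0 : x * K @[x --> 0^'+] --> (0 : R).
  rewrite -[X in _ --> X](mul0r K); apply: cvgM; last exact: cvg_cst.
  exact/cvg_at_right_filter/cvg_id.
apply: (squeeze_cvgr _ _ K0); last first.
  by rewrite -[X in _ --> X]oppr0; apply: cvgN; exact: K0.
near=> x.
have x0 : 0 < x by near: x; exact: nbhs_right_gt.
have xs : x <= s t / 2 by near: x; apply: nbhs_right_le; rewrite divr_gt0.
have /Kpx : 0 < x <= s t / 2 by rewrite x0.
rewrite ler_norml => /andP[Kl Kr].
by rewrite -mulrN !ler_pM2l// Kl Kr.
Unshelve. all: by end_near. Qed.

Lemma moment_at_front (t : R) : 0 < t ->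
  moment t x @[x --> (s t)^'-]
    --> expR t * (1 - 2 * phi * (s t * derive1 s t)).
Proof.
move=> t0.
have -> : expR t * (1 - 2 * phi * (s t * derive1 s t)) =
    expR t * (s t * (- (2 * phi * derive1 s t)) - 0 + 1) by ring.
apply: cvgM; first exact: cvg_cst.
apply: cvgD; last exact: cvg_cst.
apply: cvgB; last exact: pressure_at_front.
apply: cvgM; first exact/cvg_at_left_filter/cvg_id.
apply: cvg_trans (cvgN (front_equation sol t0)).
by apply: near_eq_cvg; apply: filterE => x; exact: opprK.
Qed.

(** The x-derivative in [moment_is_derive] is free of t and both moments vanish at 0+; monotonicity
    of the front keeps ]0, s t[ wet at the later time. *)
Lemma moment_indep (x t u : R) : 0 < t -> t <= u -> 0 < x < s t ->
  moment u x = moment t x.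
Proof.
move=> t0 tu xt; have u0 := lt_le_trans t0 tu.
apply/eqP; rewrite -subr_eq0; apply/eqP; move: x xt.
apply: (@eq_lim_of_derive0 _ (fun x => moment u x - moment t x) 0 (s t)).
  move=> x xt; have dt := moment_is_derive t0 xt.
  have du : is_derive x 1 (moment u) (2 * Y * x * expR (arrival_time s x)).
    apply: moment_is_derive => //; move: xt => /andP[-> xt]/=.
    exact: lt_le_trans xt (front_ndecr sol (ltW t0) tu).
  by apply: is_derive_eq; rewrite subrr.
by rewrite -[X in _ --> X](subrr 0); apply: cvgB; exact: moment_at_0.
Qed.

(* If s were constant on [t, u], then s' = 0 there and the limit of m at the  *)
(* front, which does not depend on the time v in ]t, u[, would equal e^v.     *)
Lemma front_incr (t u : R) : 0 <= t -> t < u -> s t < s u.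
Proof.
move=> t0 tu; rewrite lt_neqAle (front_ndecr sol t0 (ltW tu)) andbT.
apply/eqP => stu.
pose c := s t.
have sc v : t <= v <= u -> s v = c.
  move=> /andP[tv vu]; apply/eqP; rewrite eq_le.
  rewrite (front_ndecr sol t0 tv) andbT /c stu.
  by apply: (front_ndecr sol) vu; exact: le_trans tv.
have limit v : t < v < u -> moment v x @[x --> c^'-] --> expR v.
  move=> /andP[tv vu]; have v0 := le_lt_trans t0 tv.
  have scv : s v = c by rewrite sc// !ltW.
  have sv : is_derive v 1 s 0.
    apply: near_eq_is_derive (is_derive_cst c v 1).
    near=> z; rewrite sc//; apply/andP; split; apply: ltW.
      by near: z; exact: lt_nbhsr.
    by near: z; exact: lt_nbhsl.
  have := moment_at_front v0.
  by rewrite scv (is_derive1_derive1 sv) !mulr0 subr0 mulr1.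
(* Two distinct times inside ]t, u[, so that [s] is constant on a two-sided neighbourhood of
   each. *)
pose v := t + (u - t) / 3; pose w := t + (u - t) / 2.
have tv : t < v by rewrite /v; lra.
have vw : v < w by rewrite /v /w; lra.
have wu : w < u by rewrite /w; lra.
have v0 := le_lt_trans t0 tv.
have scv : s v = c by rewrite sc// !ltW// (lt_trans vw).
have lv : moment v x @[x --> c^'-] --> expR v.
  by apply: limit; rewrite tv (lt_trans vw).
have lw : moment v x @[x --> c^'-] --> expR w.
  apply: cvg_trans (limit w _); last by rewrite wu (lt_trans tv).
  apply: near_eq_cvg; near=> x; apply: moment_indep => //; first exact: ltW.
  rewrite scv; apply/andP; split.
    by near: x; apply: nbhs_left_gt; rewrite -scv; exact: (front_pos sol v0).
  by near: x; exact: nbhs_left_lt.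
have vwE : v = w by apply: expR_inj; exact: (cvg_unique _ lv lw).
by move: vw; rewrite vwE ltxx.
Unshelve. all: by end_near. Qed.

End Moment.

(** * The differential equation satisfied along the front *)

Section FrontLaw.
Context (R : realType) (phi Y : R) (s : R -> R) (p Gamma : R -> R -> R).
Hypothesis sol : is_solution phi Y s p Gamma.

Lemma arrival_front (t : R) : 0 < t -> arrival_time s (s t) = t.
Proof.
move=> t0.
have st : exists2 u, 0 <= u & s t < s u.
  exists (t + 1); first by rewrite addr_ge0// ltW.
  by apply: (front_incr sol); [exact: ltW|rewrite ltrDl].
have [h0 sh] := front_arrival sol (front_pos sol t0) st.
have [ht|ht|//] := ltgtP (arrival_time s (s t)) t.
- by have := front_incr sol (ltW h0) ht; rewrite sh ltxx.
- by have := front_incr sol (ltW t0) ht; rewrite sh ltxx.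
Qed.

Definition front_defect (t : R) : R :=
  expR t * (1 - 2 * phi * (s t * derive1 s t)).

(** At a later time [u] the point [s t] is interior, so the moment there equals its left limit,
    which by [moment_indep] is the one at time [t]. Thus V becomes a differentiable function of
    [s t], although s s' is a priori only continuous. *)
Lemma moment_front (t u : R) : 0 < t -> t < u ->
  moment p u (s t) = front_defect t.
Proof.
move=> t0 tu; have u0 := lt_trans t0 tu; have st := front_pos sol t0.
have stu := front_incr sol (ltW t0) tu.
have stu' : 0 < s t < s u by rewrite st.
have cu := is_derive1_continuous (moment_is_derive sol u0 stu').
have lu : moment p u x @[x --> (s t)^'-] --> moment p u (s t).
  exact/cvg_at_left_filter/cu.
have lt : moment p u x @[x --> (s t)^'-] --> front_defect t.
  apply: cvg_trans (moment_at_front sol t0).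
  apply: near_eq_cvg; near=> x; apply/esym.
  apply: (moment_indep sol) => //; first exact: ltW.
  apply/andP; split; first by near: x; exact: nbhs_left_gt.
  by near: x; exact: nbhs_left_lt.
exact: (cvg_unique _ lu lt).
Unshelve. all: by end_near. Qed.

(** Near [t], V is the moment at the fixed time [t + 1] composed with [s]; in the chain rule
    [arrival_front] turns e^(h(s t)) into e^t. *)
Lemma front_defect_is_derive (t : R) : 0 < t ->
  is_derive t 1 front_defect (2 * Y * s t * expR t * derive1 s t).
Proof.
move=> t0; have t1 : t < t + 1 by rewrite ltrDl.
have st : 0 < s t < s (t + 1).
  by rewrite (front_pos sol t0) (front_incr sol (ltW t0) t1).
have u0 := lt_trans t0 t1.
have dm := moment_is_derive sol u0 st; rewrite (arrival_front t0) in dm.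
have := is_derive1_comp dm (front_is_derive sol t0).
apply: near_eq_is_derive; near=> u; apply: moment_front.
  by near: u; exact: lt_nbhsr.
by near: u; exact: lt_nbhsl.
Unshelve. all: by end_near. Qed.

Lemma front_defect_at_0 : front_defect t @[t --> 0^'+] --> (0 : R).
Proof.
(* Positivity of [s] makes this a limit from the right, so that [moment_at_0] at the fixed time 1
   can be composed with [s]. *)
have s0 : s t @[t --> 0^'+] --> 0^'+.
  move=> P P0; have := front_at_0 sol P0; rewrite !near_simpl/= => sP.
  near=> t; have : 0 < s t -> P (s t) by near: t; exact: sP.
  by apply; apply: (front_pos sol); near: t; exact: nbhs_right_gt.
have lm := cvg_comp _ _ s0 (moment_at_0 sol ltr01).
apply: cvg_trans lm; apply: near_eq_cvg; near=> t.
apply/moment_front; first by near: t; exact: nbhs_right_gt.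
by near: t; exact: nbhs_right_lt.
Unshelve. all: by end_near. Qed.

End FrontLaw.

(** * Comparison of two solutions *)

Section TwoSolutions.
Context (R : realType) (phi Y : R) (hphi : 0 < phi).
Context (s1 s2 : R -> R) (p1 p2 G1 G2 : R -> R -> R).
Hypotheses (sol1 : is_solution phi Y s1 p1 G1)
           (sol2 : is_solution phi Y s2 p2 G2).

(** The difference z of the two functions V solves z' = - (Y / phi) z and tends to 0 at 0+; [D] is z
    times the integrating factor. *)
Lemma front_speed_unique (t : R) : 0 < t ->
  s1 t * derive1 s1 t = s2 t * derive1 s2 t.
Proof.
move=> t0.
pose D u := expR (Y / phi * u) * (front_defect phi s1 u - front_defect phi s2 u).
have dD u : 0 < u < t + 1 -> is_derive u 1 D 0.
  move=> /andP[u0 _].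
  have d1 := front_defect_is_derive sol1 u0.
  have d2 := front_defect_is_derive sol2 u0.
  rewrite /D; apply: is_derive_eq.
  rewrite /GRing.scale/= /front_defect; field.
  by rewrite gt_eqF.
have D0 : D u @[u --> 0^'+] --> expR (Y / phi * 0) * (0 - 0).
  apply: cvgM.
    apply: cvg_at_right_filter.
    apply: (@continuous_comp _ _ _ (fun u => Y / phi * u) expR 0).
      by apply: mulrl_continuous.
    exact: continuous_expR.
  by apply: cvgB; [exact: front_defect_at_0 sol1|exact: front_defect_at_0 sol2].
have := eq_lim_of_derive0 dD D0 (x := t); rewrite t0 ltrDl ltr01 => /(_ isT).
rewrite subrr mulr0 /D /front_defect -mulrBr => /eqP.
rewrite !mulf_eq0 !(gt_eqF (expR_gt0 _))/= => /eqP e.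
have : 2 * phi * (s1 t * derive1 s1 t - s2 t * derive1 s2 t) = 0.
  lra.
move=> /eqP; rewrite !mulf_eq0 pnatr_eq0 (gt_eqF hphi)/=.
by rewrite subr_eq0 => /eqP.
Qed.

(** The squares have equal derivatives 2 s s' and both tend to 0 at 0+; positivity selects the
    root. *)
Lemma front_unique (t : R) : 0 <= t -> s1 t = s2 t.
Proof.
rewrite le_eqVlt => /orP[/eqP <-|t0].
  by rewrite (front_start sol1) (front_start sol2).
pose D u := s1 u * s1 u - s2 u * s2 u.
have dD u : 0 < u < t + 1 -> is_derive u 1 D 0.
  move=> /andP[u0 _].
  have d1 := front_is_derive sol1 u0.
  have d2 := front_is_derive sol2 u0.
  rewrite /D; apply: is_derive_eq.
  by rewrite /GRing.scale/= (front_speed_unique u0); ring.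
have D0 : D u @[u --> 0^'+] --> (0 * 0 - 0 * 0 : R).
  by apply: cvgB; apply: cvgM;
    (exact: front_at_0 sol1 || exact: front_at_0 sol2).
have := eq_lim_of_derive0 dD D0 (x := t); rewrite t0 ltrDl ltr01 => /(_ isT).
rewrite subrr /D => /eqP; rewrite subr_eq0 -!expr2 eqf_sqr => /orP[/eqP//|/eqP e].
have := front_pos sol1 t0; have := front_pos sol2 t0; rewrite e; lra.
Qed.

Let front_eq (t : R) : 0 < t -> s2 t = s1 t.
Proof. by move=> t0; rewrite front_unique// ltW. Qed.

Lemma arrival_unique : arrival_time s1 = arrival_time s2.
Proof.
apply/funext => x; congr inf; apply/seteqP; split => t [t0 xt];
  by split => //; rewrite ?front_eq// -front_eq.
Qed.

Lemma reaction_unique (x t : R) : wet_region s1 (x, t) -> 0 < x ->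
  G1 x t = G2 x t.
Proof.
move=> [/= /andP[_ +] t0] x0; rewrite le_eqVlt => /orP[/eqP ->|xt].
  by rewrite (reaction_front sol1)// -(front_eq t0) (reaction_front sol2).
have xt1 : 0 < x < s1 t by rewrite x0.
have xt2 : 0 < x < s2 t by rewrite front_eq.
have [_ ->] := reaction_formula sol1 t0 xt1.
by have [_ ->] := reaction_formula sol2 t0 xt2; rewrite arrival_unique.
Qed.

(** Both pressures have the same p_xx, so their difference [d] is affine, and its limits 0 at both
    ends of ]0, s1 t[ force slope 0. Below, [e] is [d] minus its linear part. *)
Lemma pressure_unique (x t : R) : wet_region s1 (x, t) -> p1 x t = p2 x t.
Proof.
move=> [/= /andP[+ +] t0].
have [p10 p1s] := pressure_boundary sol1 t0.
have [p20 p2s] := pressure_boundary sol2 t0.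
rewrite front_eq// in p2s.
rewrite le_eqVlt => /orP[/eqP <- _|x0]; first by rewrite p10 p20.
rewrite le_eqVlt => /orP[/eqP ->|xs]; first by rewrite p1s p2s.
have st := front_pos sol1 t0.
pose d y := p1 y t - p2 y t.
pose d' y := derive1 (fun x => p1 x t) y - derive1 (fun x => p2 x t) y.
have dd y : 0 < y < s1 t -> is_derive y 1 d (d' y).
  move=> yt; have d1 := pressure_is_derive sol1 t0 yt.
  have d2 : is_derive y 1 (fun x => p2 x t) (derive1 (fun x => p2 x t) y).
    by apply: (pressure_is_derive sol2 t0); rewrite front_eq.
  exact: (is_deriveB d1 d2).
have dd' y : 0 < y < s1 t -> is_derive y 1 d' 0.
  move=> yt; have d1 := pressure_is_derive2 sol1 t0 yt.
  have d2 : is_derive y 1 (derive1 (fun x => p2 x t))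
      (2 * Y * expR (arrival_time s1 y - t)).
    by rewrite arrival_unique; apply: (pressure_is_derive2 sol2 t0); rewrite front_eq.
  by apply: (is_derive_eq (is_deriveB d1 d2)); rewrite subrr.
have d'E y : 0 < y < s1 t -> d' y = d' x.
  have xx : 0 < x < s1 t by rewrite x0.
  move=> /andP[y0 ys]; have [yx|xy|->//] := ltgtP y x.
    apply: (eq_of_derive0 yx) => z /andP[yz zx]; apply: dd'.
    by rewrite (lt_le_trans y0 yz) (le_lt_trans zx xs).
  apply/esym/(eq_of_derive0 xy) => z /andP[xz zy]; apply: dd'.
  by rewrite (lt_le_trans x0 xz) (le_lt_trans zy ys).
pose e y := d y - d' x * y.
have de y : 0 < y < s1 t -> is_derive y 1 e 0.
  move=> yt; have dy := dd _ yt; rewrite /e; apply: is_derive_eq.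
  by rewrite (d'E _ yt) /GRing.scale/=; ring.
have e0 : e y @[y --> 0^'+] --> (1 - 1 - d' x * 0 : R).
  apply: cvgB.
    by apply: cvgB; [exact: pressure_at_0 sol1 _ t0|exact: pressure_at_0 sol2 _ t0].
  by apply: cvgM; [exact: cvg_cst|exact/cvg_at_right_filter/cvg_id].
have eE := eq_lim_of_derive0 de e0.
rewrite subrr mulr0 subr0 in eE.
have es : e y @[y --> (s1 t)^'-] --> (0 - 0 - d' x * s1 t : R).
  apply: cvgB; last by apply: cvgM; [exact: cvg_cst|exact/cvg_at_left_filter/cvg_id].
  apply: cvgB; first exact: pressure_at_front sol1 _ t0.
  by rewrite -front_eq//; exact: pressure_at_front sol2 _ t0.
have es0 : e y @[y --> (s1 t)^'-] --> (0 : R).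
  apply: cvg_near_cst; near=> y; apply: eE; apply/andP; split.
    by near: y; exact: nbhs_left_gt.
  by near: y; exact: nbhs_left_lt.
have /eqP : 0 = 0 - 0 - d' x * s1 t by exact: (cvg_unique _ es0 es).
rewrite subrr sub0r eq_sym oppr_eq0 mulf_eq0 (gt_eqF st) orbF => /eqP d'0.
have := eE x; rewrite x0 xs /e d'0 mul0r subr0 => /(_ isT).
by rewrite /d => /eqP; rewrite subr_eq0 => /eqP.
Unshelve. all: by end_near. Qed.

Lemma solution_unique : same_solution s1 p1 G1 s2 p2 G2.
Proof.
by split; [exact: front_unique|exact: pressure_unique|exact: reaction_unique].
Qed.

End TwoSolutions.

(** * Derivatives on open sets, primitives and integrals *)

Lemma near_derive1 (R : realType) (A : set R) (f f' : R -> R) (x : R) :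
  open A -> (forall x, A x -> is_derive x 1 f (f' x)) -> A x ->
  \forall y \near x, f' y = derive1 f y.
Proof.
move=> oA df Ax; near=> y.
apply/esym/is_derive1_derive1/df; near: y.
exact: open_nbhs_nbhs.
Unshelve. all: by end_near. Qed.

(** [derive1 f] is known to be [f'] only on [A]; openness makes the two agree near each point of
    [A], which is enough to differentiate again. *)
Lemma is_derive_derive1 (R : realType) (A : set R) (f f' f'' : R -> R) :
  open A -> (forall x, A x -> is_derive x 1 f (f' x)) ->
  (forall x, A x -> is_derive x 1 f' (f'' x)) ->
  forall x, A x -> is_derive x 1 (derive1 f) (f'' x).
Proof.
move=> oA df df' x Ax.
exact: near_eq_is_derive (near_derive1 oA df Ax) (df' x Ax).
Qed.

Lemma C1_onI (R : realType) (A : set R) (f f' : R -> R) :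
  open A -> (forall x, A x -> is_derive x 1 f (f' x)) ->
  (forall x, A x -> {for x, continuous f'}) -> C1_on A f.
Proof.
move=> oA df cf; split=> [x /df[]//|].
apply/subspace_continuousP => x Ax; apply: cvg_within_filter.
have fx := is_derive1_derive1 (df x Ax).
suff : derive1 f y @[y --> x] --> derive1 f x by [].
rewrite fx; apply: cvg_trans (cf x Ax); apply: near_eq_cvg.
exact: (near_derive1 oA df Ax).
Qed.

Lemma C2_onI (R : realType) (A : set R) (f f' f'' : R -> R) :
  open A -> (forall x, A x -> is_derive x 1 f (f' x)) ->
  (forall x, A x -> is_derive x 1 f' (f'' x)) ->
  (forall x, A x -> {for x, continuous f''}) -> C2_on A f.
Proof.
move=> oA df df' cf; split=> [x /df[]//|].
exact: C1_onI oA (is_derive_derive1 oA df df') cf.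
Qed.

(** The case [a = b] is included because the double integral degenerates at x = 0 and at the
    front. *)
Lemma Rintegral_FTC2 (R : realType) (f F : R -> R) (a b : R) : a <= b ->
  (forall x, a <= x <= b -> is_derive x 1 F (f x)) ->
  (forall x, a <= x <= b -> {for x, continuous f}) ->
  \int[lebesgue_measure]_(x in `[a, b]) f x = F b - F a.
Proof.
rewrite le_eqVlt => /orP[/eqP <- _ _|ab dF cf].
  by rewrite subrr set_itv1 Rintegral_set1.
have cF x : a <= x <= b -> {for x, continuous F}.
  by move=> /dF; exact: is_derive1_continuous.
rewrite /Rintegral (@continuous_FTC2 _ f F a b ab) //.
- apply/subspace_continuousP => x /=; rewrite in_itv/= => /cf cx.
  exact: cvg_within_filter.
- split.
  + by move=> x /subset_itv_oo_cc; rewrite in_itv/= => /dF[].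
  + by apply/cvg_at_right_filter/cF; rewrite lexx ltW.
  + by apply/cvg_at_left_filter/cF; rewrite lexx ltW.
- move=> x /subset_itv_oo_cc; rewrite in_itv/= => /dF.
  exact: is_derive1_derive1.
Qed.

(** Integrating from -1 provides a two-sided derivative at 0, an end of the wet interval. *)
Lemma continuous_primitive (R : realType) (f : R -> R) : continuous f ->
  exists2 F : R -> R, F 0 = 0 & forall x : R, -1 < x -> is_derive x 1 F (f x).
Proof.
move=> cf.
pose F (x : R) := \int[lebesgue_measure]_(t in `[-1, x]) f t.
exists (fun x => F x - F 0); first by rewrite subrr.
move=> x x1.
have xx1 : x < x + 1 by rewrite ltrDl.
have intf : lebesgue_measure.-integrable `[-1, x + 1] (EFin \o f).
  apply: continuous_compact_integrable; first exact: segment_compact.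
  exact: continuous_subspaceT.
have [|dF F'] := continuous_FTC1 xx1 intf _ (cf x); first by rewrite lte_fin.
have dFx : is_derive x 1 F (f x).
  by rewrite -F'; exact: derivable_is_derive1.
by apply: is_derive_eq; rewrite subr0.
Qed.

(** * Existence *)

Section Profile.
Context (R : realType) (phi Y c : R) (w w1 : R -> R).
Hypotheses (hphi : 0 < phi) (c0 : 0 < c).
Hypotheses (w0 : w 0 = 0) (w10 : w1 0 = phi^-1).
Hypothesis dw : forall t : R, is_derive t 1 w (w1 t).
Hypothesis dw1 : forall t : R, is_derive t 1 w1 ((1 - (phi + Y) * w1 t) / phi).
Hypothesis w1c : forall t, 0 <= t -> c <= w1 t.

Let s (t : R) : R := Num.sqrt (w t).
Let sigma : R -> R := front_inv s.

Let cw : continuous w.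
Proof. by move=> t; exact: is_derive1_continuous (dw t). Qed.

Lemma profile_growth (t u : R) : 0 <= t -> t <= u -> c * (u - t) <= w u - w t.
Proof.
move=> t0; rewrite le_eqVlt => /orP[/eqP <-|tu]; first by rewrite !subrr mulr0.
have dw' z : z \in `]t, u[ -> is_derive z (1 : R) w (w1 z) by [].
have [z] := MVT tu dw' (continuous_subspaceT cw).
rewrite in_itv/= => /andP[tz _] ->; rewrite ler_wpM2r ?subr_ge0 ?(ltW tu)//.
by apply: w1c; exact: ltW (le_lt_trans t0 tz).
Qed.

Lemma profile_ge (t : R) : 0 <= t -> c * t <= w t.
Proof. by move=> t0; have := profile_growth (lexx 0) t0; rewrite w0 !subr0. Qed.

Lemma profile_gt0 (t : R) : 0 < t -> 0 < w t.
Proof.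
by move=> t0; apply: lt_le_trans (profile_ge (ltW t0)); rewrite mulr_gt0.
Qed.

Let s0 : s 0 = 0. Proof. by rewrite /s w0 sqrtr0. Qed.
Let s_ge0 (t : R) : 0 <= s t. Proof. exact: sqrtr_ge0. Qed.
Let s_gt0 (t : R) : 0 < t -> 0 < s t.
Proof. by move=> t0; rewrite sqrtr_gt0; exact: profile_gt0. Qed.

Let cs : continuous s.
Proof. by move=> t; apply: continuous_comp; [exact: cw|exact: sqrt_continuous]. Qed.

Let ds (t : R) : 0 < t -> is_derive t 1 s (w1 t / (2 * s t)).
Proof.
move=> t0; have wt := profile_gt0 t0.
by apply: (is_derive_eq (is_derive1_comp (is_derive1_sqrt wt) (dw t))); rewrite mulrC.
Qed.

Lemma sqrt_profile_incr (t u : R) : 0 <= t -> t < u -> s t < s u.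
Proof.
move=> t0 tu; rewrite /s ltr_sqrt; last exact: profile_gt0 (le_lt_trans t0 tu).
rewrite -subr_gt0; apply: lt_le_trans (profile_growth t0 (ltW tu)).
by rewrite mulr_gt0// subr_gt0.
Qed.

Let s_lt (t u : R) : 0 <= t -> 0 <= u -> (s t < s u) = (t < u).
Proof.
move=> t0 u0; have [tu|ut|->] := ltgtP t u; last by rewrite ltxx.
- exact: sqrt_profile_incr.
- by rewrite ltNge ltW// sqrt_profile_incr.
Qed.

Lemma front_inv_profile (t : R) : 0 <= t -> sigma (s t) = t.
Proof.
move=> t0; apply: pinvKV; last by rewrite inE/= in_itv/= t0.
move=> u v; rewrite !inE/= !in_itv/= !andbT => u0 v0 suv.
by have [uv|vu|//] := ltgtP u v; [move: uv|move: vu];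
  rewrite -s_lt// suv ltxx.
Qed.

Lemma profile_front_inv (x : R) : 0 <= x -> 0 <= sigma x /\ s (sigma x) = x.
Proof.
(* By [profile_ge], w T >= c T = x^2, so [s] takes the value [x] on [0, T]. *)
move=> x0; pose T := x ^+ 2 / c.
have T0 : 0 <= T by rewrite divr_ge0 ?sqr_ge0// ltW.
have xsT : x <= s T.
  rewrite -(ger0_norm x0) -sqrtr_sqr ler_wsqrtr//.
  by apply: le_trans (profile_ge T0); rewrite mulrC divfK ?gt_eqF.
have [|t + <-] := IVT T0 (continuous_subspaceT cs) (v := x).
  by rewrite s0 min_l ?s_ge0// max_r ?s_ge0// x0.
by rewrite in_itv/= => /andP[t0 _]; rewrite front_inv_profile.
Qed.

Lemma front_inv_lt (x t : R) : 0 <= x -> 0 <= t -> (sigma x < t) = (x < s t).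
Proof.
move=> x0 t0; have [h0 sh] := profile_front_inv x0.
by rewrite -[in RHS]sh s_lt.
Qed.

Lemma front_inv_gt (x t : R) : 0 <= x -> 0 <= t -> (t < sigma x) = (s t < x).
Proof.
move=> x0 t0; have [h0 sh] := profile_front_inv x0.
by rewrite -[in RHS]sh s_lt.
Qed.

Lemma front_inv_le (x t : R) : 0 <= x -> 0 <= t -> (sigma x <= t) = (x <= s t).
Proof. by move=> x0 t0; rewrite !leNgt front_inv_gt. Qed.

(* Truncation at 0 makes the inverse continuous on all of R, so that the point *)
(* 0 is interior and two-sided derivatives can be used there.                  *)
Let tau (x : R) : R := sigma (Num.max x 0).

Let tau_ge0 (x : R) : 0 <= tau x.
Proof. by apply: (profile_front_inv _).1; rewrite le_max lexx orbT. Qed.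

Let tauE (x : R) : 0 <= x -> tau x = sigma x.
Proof. by move=> x0; rewrite /tau max_l. Qed.

(** The equivalences [front_inv_lt] and [front_inv_gt] turn bounds on [tau y] into bounds on [y].
    They concern times >= 0, so a negative lower bound is handled by [tau_ge0]. *)
Lemma front_inv_continuous : continuous tau.
Proof.
move=> x; apply/cvgrPdist_lt => e e0.
have m0 y : 0 <= Num.max y 0 :> R by rewrite le_max lexx orbT.
have cm : Num.max y 0 @[y --> x] --> (Num.max x 0 : R).
  by apply: continuous_max; [exact: cvg_id|exact: cvg_cst].
have lo : \forall y \near x, tau x - e < tau y.
  have [xe|xe] := ltP (tau x - e) 0.
    by apply: filterE => y; exact: lt_le_trans xe (tau_ge0 y).
  near=> y; rewrite [ltRHS]/tau (front_inv_gt (m0 y) xe); near: y.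
  apply: (cvgr_gt (Num.max x 0) cm).
  by rewrite -(front_inv_gt (m0 x) xe) -/(tau x) ltrBlDr ltrDl.
have hi : \forall y \near x, tau y < tau x + e.
  have xe : 0 <= tau x + e by rewrite addr_ge0 ?tau_ge0 ?ltW.
  near=> y; rewrite [ltLHS]/tau (front_inv_lt (m0 y) xe); near: y.
  apply: (cvgr_lt (Num.max x 0) cm).
  by rewrite -(front_inv_lt (m0 x) xe) -/(tau x) ltrDl.
near=> y; rewrite distrC ltr_distl; apply/andP; split; near: y.
  exact: lo.
exact: hi.
Unshelve. all: by end_near. Qed.

Context (A C : R -> R).
Hypothesis dA : forall x : R, -1 < x -> is_derive x 1 A (expR (tau x)).
Hypothesis dC : forall x : R, -1 < x -> is_derive x 1 C (x * expR (tau x)).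
Hypothesis C0 : C 0 = 0.

Let s' (t : R) : R := w1 t / (2 * s t).
(* The double integral of the theorem, integrated by parts: A and C are        *)
(* primitives of e^tau and of x e^tau.                                         *)
Let p (x t : R) : R := 1 - 2 * phi * s' t * x
  - 2 * Y * (expR (- t) * (x * (A (s t) - A x) + C x)).
Let px (t x : R) : R := - (2 * phi * s' t)
  - 2 * Y * (expR (- t) * (A (s t) - A x)).
Let Gamma (x t : R) : R := 1 - expR (tau x - t).

Let cg : continuous (fun x => expR (tau x)).
Proof.
move=> x; apply: continuous_comp; first exact: front_inv_continuous.
exact: continuous_expR.
Qed.

Let cA (x : R) : -1 < x -> {for x, continuous A}.
Proof. by move=> x1; exact: is_derive1_continuous (dA x1). Qed.

Let cC (x : R) : -1 < x -> {for x, continuous C}.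
Proof. by move=> x1; exact: is_derive1_continuous (dC x1). Qed.

Let cs' (t : R) : 0 < t -> {for t, continuous s'}.
Proof.
move=> t0; apply: cvgM; first exact: is_derive1_continuous (dw1 t).
apply: cvgV; first by rewrite gt_eqF// mulr_gt0// s_gt0.
by apply: cvgM; [exact: cvg_cst|exact: cs].
Qed.

Let s'E (t : R) : 0 < t -> derive1 s t = s' t.
Proof. by move=> t0; exact: is_derive1_derive1 (ds t0). Qed.

Let dp (x t : R) : -1 < x -> is_derive x 1 (fun y => p y t) (px t x).
Proof.
move=> x1; have dAx := dA x1; have dCx := dC x1.
by apply: is_derive_eq; rewrite /px /GRing.scale/=; ring.
Qed.

Let dpx (x t : R) : -1 < x ->
  is_derive x 1 (px t) (2 * Y * (expR (- t) * expR (tau x))).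
Proof.
move=> x1; have dAx := dA x1; rewrite /px.
by apply: is_derive_eq; rewrite /GRing.scale/=; ring.
Qed.

(** This is what p = 0 at the front amounts to. Both sides have derivative Y e^t w1, by the equation
    for [w1], and both vanish at 0 since w1 0 = 1 / phi. *)
Let C_front (t : R) : 0 < t -> 2 * Y * C (s t) = expR t * (1 - phi * w1 t).
Proof.
move=> t0; pose D u := 2 * Y * C (s u) - expR u * (1 - phi * w1 u).
have dD u : 0 < u < t + 1 -> is_derive u 1 D 0.
  move=> /andP[u0 _]; have su := s_gt0 u0; have dwu := dw1 u.
  have dCs := is_derive1_comp (dC (lt_trans (ltrN10 _) su)) (ds u0).
  rewrite (tauE (ltW su)) (front_inv_profile (ltW u0)) in dCs.
  have dCs' : is_derive u 1 (fun u => C (s u)) (expR u * w1 u / 2).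
    by apply: (is_derive_eq dCs); field; rewrite gt_eqF.
  rewrite /D; apply: is_derive_eq; rewrite /GRing.scale/=; field.
  by rewrite gt_eqF.
have D0 : D u @[u --> 0^'+] --> 2 * Y * 0 - expR 0 * (1 - phi * phi^-1).
  apply: cvg_at_right_filter; apply: cvgB; apply: cvgM.
  - exact: cvg_cst.
  - suff : C (s u) @[u --> (0 : R)] --> C (s 0) by rewrite s0 C0.
    apply: continuous_comp; first exact: cs.
    by rewrite s0; apply: cC; exact: ltrN10.
  - exact: continuous_expR.
  - apply: cvgB; first exact: cvg_cst.
    apply: cvgM; first exact: cvg_cst.
    by rewrite -w10; exact: is_derive1_continuous (dw1 0).
have := eq_lim_of_derive0 dD D0 (x := t); rewrite t0 ltrDl ltr01 => /(_ isT).
rewrite divff ?gt_eqF// subrr !mulr0 subrr => /eqP.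
by rewrite subr_eq0 => /eqP.
Qed.

(** This direction serves the regularity clause: from the arrival time on, [sigma x <= t], so the
    point is wet. *)
Let arrival_ge (x : R) : 0 < x -> (exists2 t, 0 <= t & x < s t) ->
  sigma x <= arrival_time s x.
Proof.
move=> x0 [u u0 xu]; apply: lb_le_inf.
  exists u; split=> //; rewrite lt_neqAle u0 andbT; apply/eqP => u0'.
  by move: xu; rewrite -u0' s0 ltNge ltW.
by move=> t [t0 xt]; rewrite ltW// front_inv_lt// ltW.
Qed.

Let tau_le (x t : R) : wet_region s (x, t) -> tau x <= t.
Proof.
by move=> [/= /andP[x0 xs] t0]; rewrite tauE// front_inv_le// ltW.
Qed.

Let dGamma (x t : R) : is_derive t 1 (Gamma x) (expR (tau x - t)).
Proof. by rewrite /Gamma; apply: is_derive_eq; rewrite /GRing.scale/=; ring. Qed.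

(** The preimages already lie in the product sigma-algebra; each enters the completion as its union
    with the empty negligible set. *)
Let mGamma (D : set (R * R)) :
  measurable_fun (D : set (lebesgue_plane R)) (fun z => Gamma z.1 z.2).
Proof.
have mG : measurable_fun [set: measurableTypeR R * measurableTypeR R]
    (fun z => Gamma z.1 z.2).
  apply: measurable_funB; first exact: measurable_cst.
  apply: measurableT_comp; first exact: measurable_expR.
  apply: measurable_funB; last exact: measurable_snd.
  apply: measurableT_comp; last exact: measurable_fst.
  exact: continuous_measurable_fun front_inv_continuous.
move=> mD B mB; apply: measurableI => //.
have := mG measurableT B mB; rewrite setTI => mGB.
apply: sub_sigma_algebra; exists ((fun z => Gamma z.1 z.2) @^-1` B) => //.
by exists set0; [exact: negligible_set0|rewrite setU0].
Qed.

Lemma profile_solution : is_solution phi Y s p Gamma.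
Proof.
have pos_gtN1 (x : R) : 0 < x -> -1 < x by move=> x0; exact: lt_trans (ltrN10 _) x0.
split.
- by [].
- exact: continuous_subspaceT.
- apply: (C1_onI (f' := s')); first exact: interval_open.
  + by move=> t; rewrite /= in_itv/= andbT => /ds.
  + by move=> t; rewrite /= in_itv/= andbT => /cs'.
- apply/subspace_continuousP => -[x t] [/= /andP[x0 _] t0].
  apply: cvg_within_filter.
  have x1 : -1 < x := lt_le_trans (ltrN10 _) x0.
  have c1 : {for (x, t), continuous (@fst R R)} by exact: cvg_fst.
  have c2 : {for (x, t), continuous (@snd R R)} by exact: cvg_snd.
  have comp1 (f : R -> R) : {for x, continuous f} ->
      {for (x, t), continuous (fun z : R * R => f z.1)}.
    by move=> cf; apply: continuous_comp; [exact: c1|exact: cf].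
  have comp2 (f : R -> R) : {for t, continuous f} ->
      {for (x, t), continuous (fun z : R * R => f z.2)}.
    by move=> cf; apply: continuous_comp; [exact: c2|exact: cf].
  have cAs : {for t, continuous (fun u => A (s u))}.
    apply: continuous_comp; first exact: cs.
    by apply: cA; exact/pos_gtN1/s_gt0.
  apply: cvgB.
    apply: cvgB; first exact: cvg_cst.
    apply: cvgM; last exact: c1.
    by apply: cvgM; [exact: cvg_cst|exact/comp2/cs'].
  apply: cvgM; first exact: cvg_cst.
  apply: cvgM.
    apply: (comp2 (fun u => expR (- u))).
    by apply: continuous_comp; [exact: opp_continuous|exact: continuous_expR].
  apply: cvgD; last exact/comp1/cC.
  apply: cvgM; first exact: c1.
  by apply: cvgB; [exact: (comp2 (fun u => A (s u)))|exact/comp1/cA].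
- move=> t t0; apply: (@C2_onI _ `]0, (s t)[%classic (fun x => p x t) (px t)
    (fun x => 2 * Y * (expR (- t) * expR (tau x)))).
  + exact: interval_open.
  + by move=> x; rewrite /= in_itv/= => /andP[/pos_gtN1 x1 _]; exact: dp.
  + by move=> x; rewrite /= in_itv/= => /andP[/pos_gtN1 x1 _]; exact: dpx.
  + move=> x _; apply: cvgM; first exact: cvg_cst.
    by apply: cvgM; [exact: cvg_cst|exact: cg].
- exists 1 => x t /tau_le xt.
  have e1 : expR (tau x - t) <= 1 by rewrite -expR0 ler_expR subr_le0.
  have e0 := expR_gt0 (tau x - t).
  by rewrite ler_norml /Gamma; apply/andP; split; lra.
- exact: mGamma.
- move=> x x0 xu; have hge := arrival_ge x0 xu.
  have [h0 sh] := profile_front_inv (ltW x0).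
  have h_gt0 : 0 < sigma x by rewrite front_inv_gt ?lexx ?s0// ltW.
  split.
  + move=> t ht; have xt := le_trans hge ht; have t0 := lt_le_trans h_gt0 xt.
    by split => //=; rewrite (ltW x0)/= -front_inv_le// ltW.
  + apply: (C1_onI (f' := fun t => expR (tau x - t))).
    * exact: interval_open.
    * by move=> t _; exact: dGamma.
    * move=> t _; apply: continuous_comp; last exact: continuous_expR.
      by apply: cvgB; [exact: cvg_cst|exact: cvg_id].
  + apply: continuous_subspaceT => t; exact: is_derive1_continuous (dGamma x t).
- move=> x t t0 /andP[x0 xs].
  have -> : 2 * Y * (1 - Gamma x t) = 2 * Y * (expR (- t) * expR (tau x)).
    by rewrite /Gamma subKr addrC expRD.
  apply: is_derive1_derive1.
  apply: (@is_derive_derive1 _ `]0, (s t)[%classic (fun x => p x t) (px t)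
    (fun x => 2 * Y * (expR (- t) * expR (tau x)))).
  + exact: interval_open.
  + by move=> y; rewrite /= in_itv/= => /andP[/pos_gtN1 y1 _]; exact: dp.
  + by move=> y; rewrite /= in_itv/= => /andP[/pos_gtN1 y1 _]; exact: dpx.
  + by rewrite /= in_itv/= x0.
- move=> t t0; have st := s_gt0 t0.
  (* The formula for [px] is differentiable across the front, so the one-sided limit is its value
     there, where the term in [A] vanishes. *)
  have px_s : - px t x @[x --> (s t)^'-] --> - px t (s t).
    apply/cvg_at_left_filter; apply: cvgN.
    exact: is_derive1_continuous (dpx t (pos_gtN1 _ st)).
  have <- : - px t (s t) = 2 * phi * derive1 s t.
    by rewrite s'E// /px subrr !mulr0 subr0 opprK.
  apply: cvg_trans px_s; apply: near_eq_cvg; near=> x.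
  congr (- _); apply/esym/is_derive1_derive1/dp/pos_gtN1.
  by near: x; exact: nbhs_left_gt.
- move=> x t t0 xs; rewrite (is_derive1_derive1 (dGamma x t)).
  by rewrite /Gamma subKr.
- move=> t t0; have st := s_gt0 t0; split.
    by rewrite /p C0 !mul0r mulr0 add0r !mulr0 !subr0.
  (* By [C_front] the last term becomes 1 - phi w1, and 2 s s' = w1 gives the cancellation. *)
  rewrite /p subrr mulr0 add0r.
  have -> : 2 * Y * (expR (- t) * C (s t)) = expR (- t) * (2 * Y * C (s t)).
    by ring.
  rewrite (C_front t0) mulrA -expRD addNr expR0 /s'; field.
  by rewrite gt_eqF.
- move=> t t0; rewrite /Gamma tauE// front_inv_profile; last exact: ltW.
  by rewrite subrr expR0 subrr.
- exact: s0.
Unshelve. all: by end_near. Qed.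

(** Two uses of the fundamental theorem of calculus. In the derivative of the outer primitive y (A
    (s t) - A y) + C y the terms y e^(tau y) cancel. *)
Lemma profile_pressure (x t : R) : 0 < t -> 0 <= x <= s t ->
  p x t = 1 - 2 * phi * derive1 s t * x
    - 2 * Y * \int[lebesgue_measure]_(y in `[0, x])
                \int[lebesgue_measure]_(z in `[y, s t])
                  expR (sigma z - t).
Proof.
move=> t0 /andP[x0 xs]; rewrite s'E// /p; congr (_ - _ * _).
have ge0_gtN1 (y : R) : 0 <= y -> -1 < y.
  by move=> y0; exact: lt_le_trans (ltrN10 _) y0.
have inner (y : R) : 0 <= y <= x ->
    \int[lebesgue_measure]_(z in `[y, s t]) expR (sigma z - t) =
    expR (- t) * (A (s t) - A y).
  move=> /andP[y0 yx].
  transitivity (\int[lebesgue_measure]_(z in `[y, s t])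
      (expR (- t) * expR (tau z))).
    apply: eq_Rintegral => z; rewrite inE/= in_itv/= => /andP[yz _].
    by rewrite tauE ?(le_trans y0)// addrC expRD.
  have dE z : y <= z <= s t -> is_derive z 1 (fun z => expR (- t) * A z)
      (expR (- t) * expR (tau z)).
    move=> /andP[yz _]; have dAz := dA (ge0_gtN1 _ (le_trans y0 yz)).
    by apply: is_derive_eq; rewrite /GRing.scale/=; ring.
  rewrite (Rintegral_FTC2 (le_trans yx xs) dE); first by rewrite mulrBr.
  by move=> z _; apply: cvgM; [exact: cvg_cst|exact: cg].
transitivity (\int[lebesgue_measure]_(y in `[0, x])
    (expR (- t) * (A (s t) - A y))); last first.
  by apply: eq_Rintegral => y; rewrite inE/= in_itv/= => /inner.
have dE y : 0 <= y <= x ->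
    is_derive y 1 (fun y => expR (- t) * (y * (A (s t) - A y) + C y))
      (expR (- t) * (A (s t) - A y)).
  move=> /andP[/ge0_gtN1 y1 _]; have dAy := dA y1; have dCy := dC y1.
  by apply: is_derive_eq; rewrite /GRing.scale/=; ring.
rewrite (Rintegral_FTC2 x0 dE); first by rewrite C0 mul0r addr0 mulr0 subr0.
move=> y /andP[/ge0_gtN1 y1 _]; apply: cvgM; first exact: cvg_cst.
by apply: cvgB; [exact: cvg_cst|exact: cA].
Qed.

End Profile.

(** * The explicit profile and the lower bound on its derivative *)

Lemma profile_exists (R : realType) (phi Y : R) : 0 < phi ->
  exists (w w1 : R -> R) (c : R),
    [/\ [/\ 0 < c, w 0 = 0 & w1 0 = phi^-1],
        forall t : R, is_derive t 1 w (w1 t),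
        forall t : R, is_derive t 1 w1 ((1 - (phi + Y) * w1 t) / phi),
        forall t, 0 <= t -> c <= w1 t &
        forall t,
          (phi + Y != 0 -> w t = t / (phi + Y) + Y / (phi + Y) ^+ 2
                                   * (1 - expR (- ((1 + Y / phi) * t)))) /\
          (phi + Y = 0 -> w t = t / phi + t ^+ 2 / (2 * phi))].
Proof.
move=> phi0; have phi_neq0 : phi != 0 by rewrite gt_eqF.
have [k0|k_neq0] := eqVneq (phi + Y) 0.
  exists (fun t => t / phi + t * t / (2 * phi)), (fun t => phi^-1 + t / phi), phi^-1.
  split; first by rewrite invr_gt0 !mul0r !addr0.
  - by move=> t; apply: is_derive_eq; rewrite /GRing.scale/=; field.
  - by move=> t; apply: is_derive_eq; rewrite k0 /GRing.scale/=; field.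
  - by move=> t t0; rewrite lerDl divr_ge0// ltW.
  - by move=> t; split => // /eqP; rewrite k0.
pose E t := expR (- ((1 + Y / phi) * t)).
have E0 : E 0 = 1 by rewrite /E mulr0 oppr0 expR0.
exists (fun t => t / (phi + Y) + Y / (phi + Y) ^+ 2 * (1 - E t)).
exists (fun t => (phi + Y)^-1 + Y / (phi * (phi + Y)) * E t).
(* For Y >= 0 the exponential term of w' is nonnegative and 1 / (phi + Y) remains; for Y < 0, w'
   increases from its initial value 1 / phi. *)
exists (if 0 <= Y then (phi + Y)^-1 else phi^-1).
split.
- split.
  + have [Y0|_] := leP 0 Y; last by rewrite invr_gt0.
    by rewrite invr_gt0 ltr_wpDr.
  + by rewrite E0 subrr mulr0 mul0r addr0.
  + by rewrite E0; field; rewrite ?k_neq0 ?phi_neq0.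
- move=> t; rewrite /E; apply: is_derive_eq; rewrite /GRing.scale/=; field.
  by rewrite ?k_neq0 ?phi_neq0.
- move=> t; rewrite /E; apply: is_derive_eq; rewrite /GRing.scale/=; field.
  by rewrite ?k_neq0 ?phi_neq0.
- move=> t t0; have Et := expR_gt0 (- ((1 + Y / phi) * t)).
  have [Y0|Y0] := leP 0 Y.
    rewrite lerDl mulr_ge0 ?(ltW Et)// divr_ge0// mulr_ge0 ?(ltW phi0)//.
    by rewrite addr_ge0// ltW.
  rewrite -subr_ge0.
  have -> : (phi + Y)^-1 + Y / (phi * (phi + Y)) * E t - phi^-1 =
      - Y / phi * ((1 - E t) / (phi + Y)) by field; rewrite ?k_neq0 ?phi_neq0.
  apply: mulr_ge0; first by rewrite divr_ge0 ?oppr_ge0 ?(ltW Y0) ?(ltW phi0).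
  (* The exponent of [E t] is - t (phi + Y) / phi, so [1 - E t] and phi + Y have compatible signs
     and their quotient is nonnegative. *)
  have kE : 1 + Y / phi = (phi + Y) / phi by field.
  have [kp|kn] := ltP 0 (phi + Y).
    rewrite divr_ge0 ?(ltW kp)// subr_ge0 /E -[leRHS]expR0 ler_expR oppr_le0 kE.
    by rewrite mulr_ge0 ?divr_ge0 ?(ltW kp) ?(ltW phi0).
  rewrite mulr_le0 ?invr_le0// subr_le0 /E -[leLHS]expR0 ler_expR oppr_ge0 kE.
  by rewrite mulr_le0_ge0// pmulr_lle0 ?invr_gt0.
- by move=> t; split => // k0; rewrite k0 eqxx in k_neq0.
Qed.

Unset Implicit Arguments.

Theorem theorem1 (R : realType) (phi Y : R) (hphi : 0 < phi) :
  exists (s : R -> R) (p Gamma : R -> R -> R),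
    [/\ is_solution phi Y s p Gamma,
        forall (s' : R -> R) (p' Gamma' : R -> R -> R),
          is_solution phi Y s' p' Gamma' ->
          same_solution s p Gamma s' p' Gamma',
        {in `[0, +oo[ &, {homo s : t u / t < u}},
        forall t, 0 <= t ->
          (phi + Y != 0 -> s t =
             Num.sqrt (t / (phi + Y) + Y / (phi + Y) ^+ 2
                         * (1 - expR (- ((1 + Y / phi) * t))))) /\
          (phi + Y = 0 -> s t = Num.sqrt (t / phi + t ^+ 2 / (2 * phi))) &
        forall x t, 0 < t -> 0 <= x <= s t ->
          Gamma x t = 1 - expR (front_inv s x - t) /\
          p x t = 1 - 2 * phi * derive1 s t * x
            - 2 * Y * \int[lebesgue_measure]_(y in `[0, x])
                        \int[lebesgue_measure]_(z in `[y, s t])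
                          expR (front_inv s z - t)].
Proof.
have [w [w1 [c [[c0 w0 w10] dw dw1 w1c wE]]]] := profile_exists Y hphi.
have cg := front_inv_continuous c0 w0 dw w1c.
pose s (t : R) : R := Num.sqrt (w t).
pose g (x : R) : R := expR (front_inv s (Num.max x 0)).
have cg' : continuous g.
  by move=> x; apply: continuous_comp; [exact: cg|exact: continuous_expR].
have [A _ dA] := continuous_primitive cg'.
have [C C0 dC] : exists2 C : R -> R, C 0 = 0 &
    forall x : R, -1 < x -> is_derive x 1 C (x * g x).
  by apply: continuous_primitive => x; apply: cvgM; [exact: cvg_id|exact: cg'].
have sol := profile_solution hphi c0 w0 w10 dw dw1 w1c dA dC C0.
(* Unification supplies the witnesses from [sol]. Its Gamma uses the inverse truncated at 0, which
   agrees with [front_inv s] for x >= 0. *)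
do 3 eexists; split; first exact: sol.
- by move=> s' p' Gamma'; exact: solution_unique.
- move=> t u; rewrite !in_itv/= !andbT => t0 _.
  exact: (sqrt_profile_incr c0 w0 dw w1c).
- by move=> t _; split => k; have [w1E w2E] := wE t; rewrite -?w1E -?w2E.
- move=> x t t0 xs; split; first by case/andP: xs => x0 _; rewrite max_l.
  exact: (profile_pressure phi Y c0 w0 dw w1c dA dC C0).
Qed.
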